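(* Let $A\in\mathbb C^{n\times n}$ be a partial isometry of rank $k$ whose Kippenhahn curve satisfies $C(A)\supset\mathcal C_{1/2}$. Suppose that in a representation of $A$, up to unitary similarity, as $$\begin{bmatrix}0&B\\0&C\end{bmatrix},$$ where the upper left block is $m\times m$ with $m=\dim\ker A=n-k$ (so $C\in\mathbb C^{k\times k}$), one has $$\dim\ker C\ \ge\ \left\lfloor \tfrac{k}{2}\right\rfloor .$$ Then $A$ is unitarily reducible with one of the blocks equal to $J_2=\begin{bmatrix}0&1\\0&0\end{bmatrix}$, i.e. $A$ is unitarily similar to a block diagonal matrix one of whose diagonal blocks is $J_2$.
   Context: A matrix $A$ is a partial isometry if $\|Ax\|=\|x\|$ for all $x\perp\ker A$. Put $\operatorname{Re}X=(X+X^* )/2$. The Kippenhahn polynomial of $A\in\mathbb C^{n\times n}$ is $P_A(\lambda,\theta)=\det(\operatorname{Re}(e^{i\theta}A)-\lambda I)$. With $\lambda_1(\theta),\dots,\lambda_n(\theta)$ its roots in $\lambda$, the Kippenhahn curve $C(A)$ is the envelope of the family of lines $\{e^{-i\theta}(\lambda_j(\theta)+i\mathbb R):\theta\in(-\pi,\pi],\ j=1,\dots,n\}$. $\mathcal C_r$ is the circle of radius $r>0$ centered at $0$. The containment $C(A)\supset\mathcal C_r$ holds if and only if, for all $\theta$, $P_A(\lambda,\theta)$ is divisible by $\lambda^2-r^2$ as a polynomial in $\lambda$ (this may be taken as its definition). The block diagonal matrix may consist of the single block $J_2$ (the case $A$ unitarily similar to $J_2$). *)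

(* Defs.v *)
From HB Require Import structures.
From mathcomp Require Import all_boot all_order all_algebra.
From mathcomp Require Import all_classical all_reals all_analysis.
From mathcomp Require Import complex.

Set Implicit Arguments.
Unset Strict Implicit.
Unset Printing Implicit Defensive.

Import Order.TTheory GRing.Theory Num.Theory.

Local Open Scope ring_scope.
Local Open Scope sesquilinear_scope.
Local Open Scope complex_scope.

(* [dotmx] is defined on row vectors, hence the transpositions: this is
   sum_i x_i * conj y_i for column vectors x and y. *)
Definition cdot (C : numClosedFieldType) (n : nat) (x y : 'cV[C]_n) : C :=
  dotmx x^T y^T.

Definition cnorm (C : numClosedFieldType) (n : nat) (x : 'cV[C]_n) : C :=
  sqrtC (cdot x x).

Definition partial_isometry (C : numClosedFieldType) (n : nat) (A : 'M[C]_n) :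
    Prop :=
  forall x : 'cV[C]_n,
    (forall y : 'cV[C]_n, A *m y = 0 -> cdot x y = 0) ->
    cnorm (A *m x) = cnorm x.

(* Dimension of the right kernel {x : 'cV_n | A *m x = 0}, which is the column
   space of [cokermx A]; [kermx A] is the kernel of A acting on row vectors. *)
Definition dim_ker (F : fieldType) (n : nat) (A : 'M[F]_n) : nat :=
  \rank (cokermx A).

(* The sizes n and p are syntactically independent, which avoids casts between
   e.g. 'M_n and 'M_((n - k) + k). In MathComp, U \is unitarymx only says
   U *m U ^t* = 1 for a rectangular U; the two conditions together make U a
   unitary matrix and force n = p. *)
Definition unitarily_similar (C : numClosedFieldType) (n p : nat)
    (A : 'M[C]_n) (B : 'M[C]_p) : Prop :=
  exists U : 'M[C]_(n, p),
    [/\ U \is unitarymx, U ^t* \is unitarymx & A = U *m B *m U ^t*].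

Definition Remx (C : numClosedFieldType) (n : nat) (X : 'M[C]_n) : 'M[C]_n :=
  2^-1 *: (X + X ^t*).

Definition expi (R : realType) (theta : R) : R[i] := cos theta +i* sin theta.

(* lambda |-> det(Re(e^(i theta) A) - lambda I), with lambda encoded as 'X. *)
Definition kippenhahn_poly (R : realType) (n : nat) (A : 'M[R[i]]_n)
    (theta : R) : {poly R[i]} :=
  \det (map_mx polyC (Remx (expi theta *: A)) - 'X%:M).

(* The circle of radius r centered at 0 is the envelope of the lines
   e^(- i theta) (+/- r + iR), so the Kippenhahn curve of A contains it if and
   only if r and - r are, for every theta, among the roots in lambda of the
   Kippenhahn polynomial. *)
Definition kippenhahn_contains_circle (R : realType) (n : nat)
    (A : 'M[R[i]]_n) (r : R) : Prop :=
  forall theta : R, 'X^2 - ((r ^+ 2)%:C)%:P %| kippenhahn_poly A theta.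

Definition J2 (F : fieldType) : 'M[F]_2 := delta_mx 0 1.

(* Main.v *)
Require Import Defs.
From HB Require Import structures.
From mathcomp Require Import all_boot all_order all_algebra.
From mathcomp Require Import all_classical all_reals all_analysis.
From mathcomp Require Import complex zify.

Set Implicit Arguments.
Unset Strict Implicit.
Unset Printing Implicit Defensive.

Import Order.TTheory GRing.Theory Num.Theory.

Local Open Scope ring_scope.
Local Open Scope complex_scope.
Local Open Scope sesquilinear_scope.

(** A block [J2] splits off as soon as [C] and [C^*] have a common kernel vector
    [y]: if [y] is a unit vector then [e2 = (0, y)] and its image [e1] are
    orthonormal, both the matrix and its adjoint preserve their span, and the
    matrix maps [e2] to [e1] and [e1] to [0] ([J2_block]). The orthogonal
    complement of that plane carries the remaining block ([reducing_block]).

    For the existence of [y], the angle [0] alone is used: the divisibility of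
    the Kippenhahn polynomial says that [Re A] has the two eigenvalues [1/2] and
    [-1/2], so that [A + A^*] has eigenvectors for [e = 1] and [e = -1].
    A partial isometry of rank [k] satisfies [B^* B + C^* C = 1]
    ([partial_isometry_block]), and eliminating the first component of an
    eigenvector leaves a nonzero [b] with [C^* C b = e (C + C^* ) b]
    ([block_eigenvector]).

    Let [K = ker C] and suppose that [K] meets [ker C^*] trivially
    ([ker_cap_adjoint_neq0]). Pairing the equation with [K] shows that [b] lies
    in [W], the space of all [w] with [C w] orthogonal to [K]. As [C^*] is
    injective on [K], the dimension of [W] is [k - dim K], at most [dim K + 1],
    while [W] contains [K]. Neither of the two vectors lies in [K], since
    otherwise its equation would put it in [ker C^*] too. Hence [W] is [K] plus a
    line, and modulo [K] the two vectors are proportional. Up to a positive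
    factor they therefore give the same value of the form [<C b, b>], as well as
    the same norm of [C b], and their equations read
    [|C b|^2 = 2 Re <C b, b>] and [|C b|^2 = - 2 Re <C b, b>]. So [C b = 0],
    which contradicts that [b] is not in [K].

    Ranks and kernels of matrices refer to row vectors, so the argument is
    carried out with conjugate transposes: a column [y] becomes the row [y^*],
    on which [C^*] acts from the right. *)

(** * Conjugate transposes *)

Lemma trmxCM (F : numClosedFieldType) m n p (A : 'M[F]_(m, n))
    (B : 'M[F]_(n, p)) :
  (A *m B) ^t* = B ^t* *m A ^t*.
Proof. by rewrite trmx_mul map_mxM. Qed.

Lemma trmxCD (F : numClosedFieldType) m n (A B : 'M[F]_(m, n)) :
  (A + B) ^t* = A ^t* + B ^t*.
Proof. by rewrite raddfD /= map_mxD. Qed.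

Lemma trmxC0 (F : numClosedFieldType) m n :
  (0 : 'M[F]_(m, n)) ^t* = 0.
Proof. by rewrite trmx0 map_mx0. Qed.

Lemma trmxC1 (F : numClosedFieldType) n : (1%:M : 'M[F]_n) ^t* = 1%:M.
Proof. by rewrite trmx1 map_mx1. Qed.

Lemma mulmx_trmxC_eq0 (F : numClosedFieldType) m n (A : 'M[F]_(m, n)) :
  A *m A ^t* = 0 -> A = 0.
Proof.
move=> /orthomx1P/orthomx_disj A0.
by apply/eqP; rewrite -submx0 -A0 sub_capmx submx_refl.
Qed.

Lemma hermitian_form_eq0 (F : numClosedFieldType) n (H : 'M[F]_n) :
  H ^t* = H -> (forall v : 'rV_n, v *m H *m v ^t* = 0) -> H = 0.
Proof.
move=> Hh H0; apply/row_matrixP => i; rewrite row0 rowE.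
set v := delta_mx 0 i; pose w := v *m H.
(* Testing the form at [v + w] isolates its cross terms, each equal to
   [w w^*]. *)
apply: mulmx_trmxC_eq0; rewrite -/w.
have wE : w *m w ^t* = w *m H *m v ^t* by rewrite {2}/w trmxCM Hh mulmxA.
have := H0 (v + w).
rewrite trmxCD !mulmxDl !mulmxDr !H0 add0r addr0 -wE -/w => /eqP.
by rewrite -mulr2n -scaler_nat scaler_eq0 pnatr_eq0 /= => /eqP.
Qed.

(** * Common kernel vectors of a matrix and its adjoint *)

(** The two vectors [b] and [c] are the witnesses, for [z = 1] and [z = -1], of
    the singularity of [M M^* - z (M + M^* )]. *)
Lemma ker_cap_adjoint_neq0 (F : numClosedFieldType) k (M : 'M[F]_k)
    (b c : 'rV[F]_k) :
  b != 0 -> c != 0 ->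
  b *m M *m M ^t* = b *m (M + M ^t*) ->
  c *m M *m M ^t* = - (c *m (M + M ^t*)) ->
  (k %/ 2 <= \rank (kermx M))%N ->
  (kermx M :&: kermx (M ^t*))%MS != 0.
Proof.
move=> b0 c0 bM cM dimK; apply/negP => /eqP cap0.
(* [W] consists of the rows [w] such that [w M] is orthogonal to [K]. *)
set K := kermx M; pose W := kermx (M *m K ^t*).
have MK0 : M ^t* *m K ^t* = 0 by rewrite -trmxCM mulmx_ker trmxC0.
have rankMK : \rank (M *m K ^t*) = \rank K.
  rewrite -mxrank_tr -(mxrank_map Num.conj) trmxCM trmxCK.
  by rewrite -[RHS](mxrank_mul_ker _ (M ^t*)) cap0 mxrank0 addn0.
have rankW : (\rank W <= (\rank K).+1)%N.
  rewrite mxrank_ker rankMK leq_subLR.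
  by move: (\rank K) dimK => d; lia.
have KW : (K <= W)%MS by apply/sub_kermxP; rewrite mulmxA mulmx_ker mul0mx.
have bW : (b <= W)%MS.
  apply/sub_kermxP; have := congr1 (mulmx^~ (K ^t*)) bM.
  by rewrite /= -!mulmxA mulmxDl MK0 addr0 !mulmx0 => <-.
have cW : (c <= W)%MS.
  apply/sub_kermxP; have := congr1 (mulmx^~ (K ^t*)) cM.
  rewrite /= -!mulmxA mulNmx -!mulmxA mulmxDl MK0 addr0 !mulmx0 => /eqP.
  by rewrite eq_sym oppr_eq0 => /eqP.
have notK (v : 'rV_k) : v != 0 -> v *m M ^t* = 0 -> v *m M = 0 -> False.
  move=> v0 vM vN; move/negP: v0; apply.
  by rewrite -submx0 -cap0 sub_capmx !(introT sub_kermxP).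
have bK : ~~ (b <= K)%MS.
  apply/negP => /sub_kermxP bM0; move: bM; rewrite mulmxDr bM0 mul0mx add0r.
  by move=> /esym bN0; exact: (notK b).
have cK : ~~ (c <= K)%MS.
  apply/negP => /sub_kermxP cM0; move/eqP: cM.
  rewrite mulmxDr cM0 mul0mx add0r eq_sym oppr_eq0 => /eqP cN0.
  exact: (notK c).
have Kb : ((K + b)%MS :=: W)%MS.
  have KbW : (K + b <= W)%MS by rewrite addsmx_sub KW.
  apply/eqmxP; rewrite -(mxrank_leqif_eq KbW).
  rewrite eqn_leq mxrankS //= (leq_trans rankW) //.
  have KKb : (K < K + b)%MS.
    by rewrite ltmxE addsmxSl /= addsmx_sub submx_refl /=.
  exact: rank_ltmx.
have /sub_addsmxP [[u t] /= cE] : (c <= K + b)%MS by rewrite Kb.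
have cE' : c *m M = t *m (b *m M).
  by rewrite cE mulmxDl -mulmxA mulmx_ker mulmx0 add0r mulmxA.
have t0 : t 0 0 != 0.
  apply: contraNneq cK => t00.
  by rewrite cE [t]mx11_scalar t00 raddf0 mul0mx addr0 submxMl.
have Kker : b *m M *m K ^t* = 0.
  by rewrite -mulmxA; apply/sub_kermxP.
(* The component [u K] of [c] does not contribute to [c M c^*]: it is killed by
   [M] on the left, and orthogonal to [c M] on the right. *)
set p := b *m M *m b ^t*.
have cMc : c *m M *m c ^t* = t *m p *m t ^t*.
  have -> : c ^t* = K ^t* *m u ^t* + b ^t* *m t ^t*.
    by rewrite cE trmxCD !trmxCM.
  rewrite cE' mulmxDr [_ *m (K ^t* *m _)]mulmxA -[t *m _ *m K ^t*]mulmxA.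
  by rewrite Kker mulmx0 mul0mx add0r !mulmxA.
have adj (v : 'rV_k) : v *m M ^t* *m v ^t* = (v *m M *m v ^t*) ^t*.
  by rewrite !trmxCM trmxCK mulmxA.
have Eb : (b *m M) *m (b *m M) ^t* = p + p ^t*.
  by rewrite trmxCM mulmxA bM mulmxDr mulmxDl adj.
have Ec : t *m ((b *m M) *m (b *m M) ^t*) *m t ^t* =
    - (t *m (p + p ^t*) *m t ^t*).
  rewrite mulmxA -mulmxA -trmxCM -cE' trmxCM mulmxA cM mulNmx mulmxDr mulmxDl.
  rewrite adj cMc [in LHS]trmxCM [in LHS]trmxCM trmxCK mulmxDr mulmxDl.
  by rewrite !mulmxA.
move: Ec; rewrite -Eb => /eqP; rewrite -addr_eq0 -mulr2n -scaler_nat.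
rewrite scaler_eq0 pnatr_eq0 /=.
rewrite [t]mx11_scalar tr_scalar_mx map_scalar_mx mul_scalar_mx mul_mx_scalar.
rewrite !scaler_eq0 conjC_eq0 (negPf t0) /= => /eqP/mulmx_trmxC_eq0 bM0.
by move/negP: bK; apply; apply/sub_kermxP.
Qed.

(** * Splitting off a reducing block *)

Lemma unitarily_similar_trans (F : numClosedFieldType) m n p (A : 'M[F]_m)
    (B : 'M[F]_n) (D : 'M[F]_p) :
  unitarily_similar A B -> unitarily_similar B D -> unitarily_similar A D.
Proof.
move=> [U [U1 U2 ->]] [V [V1 V2 ->]]; exists (U *m V); split.
- exact: mul_unitarymx.
- by rewrite trmxCM; exact: mul_unitarymx.
- by rewrite trmxCM !mulmxA.
Qed.

(** The rows of [Q] span a reducing subspace, whose orthogonal complement is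
    given an orthonormal basis by the Gram-Schmidt process. *)
Lemma reducing_block (F : numClosedFieldType) n q (A : 'M[F]_n)
    (J : 'M[F]_q) (Q : 'M[F]_(q, n)) :
  Q \is unitarymx -> Q *m A = J *m Q -> Q *m A ^t* = J ^t* *m Q ->
  exists p (D : 'M[F]_p), unitarily_similar A (block_mx J 0 0 D).
Proof.
move=> Qu QA QA'.
set O := orthomx Num.conj (mx_of_hermitian (hermitian1mx _)) Q.
pose P := schmidt (row_base O).
have Pu : P *m P ^t* = 1%:M.
  by apply/unitarymxP; rewrite schmidt_unitarymx // rank_leq_col.
have PQ : P *m Q ^t* = 0.
  apply/orthomx1P; rewrite eqmx_schmidt_free ?row_base_free //.
  by rewrite eq_row_base.
have QP : Q *m P ^t* = 0 by rewrite -[Q]trmxCK -trmxCM PQ trmxC0.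
pose V := col_mx Q P.
have VE : V ^t* = row_mx (Q ^t*) (P ^t*) by rewrite tr_col_mx map_row_mx.
have Vu : V *m V ^t* = 1%:M.
  rewrite VE mul_col_row (unitarymxP Qu) Pu PQ QP.
  by rewrite -scalar_mx_block.
have V'V : V ^t* *m V = 1%:M.
  have : row_full V.
    rewrite /row_full mxrank_unitary; last exact/unitarymxP.
    by rewrite -(mxrank_unitary Qu) add_rank_ortho.
  move=> /row_fullP [L LV].
  by rewrite -[V ^t*]mul1mx -LV -[L *m V *m _]mulmxA Vu mulmx1.
exists (\rank O), (P *m A *m P ^t*), (V ^t*); split.
- by apply/unitarymxP; rewrite trmxCK.
- by apply/unitarymxP; rewrite trmxCK.
rewrite trmxCK.
suff <- : V *m A *m V ^t* = block_mx J 0 0 (P *m A *m P ^t*).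
  by rewrite !mulmxA V'V mul1mx -mulmxA V'V mulmx1.
have AQ : A *m Q ^t* = Q ^t* *m J.
  by rewrite -[A]trmxCK -trmxCM QA' trmxCM trmxCK.
rewrite VE mul_col_mx mul_col_row QA -!mulmxA AQ QP mulmx0.
by rewrite [P *m (_ *m J)]mulmxA PQ mul0mx (unitarymxP Qu) mulmx1.
Qed.

(** A nonzero subspace contains a unit vector; [schmidt] normalizes a row. *)
Lemma unit_row_vector (F : numClosedFieldType) m n (A : 'M[F]_(m, n)) :
  A != 0 -> exists2 x : 'rV[F]_n, x *m x ^t* = 1%:M & (x <= A)%MS.
Proof.
move=> /rowV0Pn [v vA v0]; exists (schmidt v).
  apply/unitarymxP/schmidt_unitarymx.
  by case: n {A vA} v v0 => // v; rewrite [v]thinmx0 eqxx.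
by rewrite eqmx_schmidt_free // /row_free rank_rV v0.
Qed.

(** The rows [f] and [g] of the proof are the adjoints of [e2 = (0, x^* )] and
    [e1], the image of [e2] under the block matrix. *)
Lemma J2_block (F : numClosedFieldType) m k (B : 'M[F]_(m, k))
    (C : 'M[F]_k) (x : 'rV[F]_k) :
  B ^t* *m B + C ^t* *m C = 1%:M ->
  x *m x ^t* = 1%:M -> x *m C ^t* = 0 -> x *m C = 0 ->
  exists p (D : 'M[F]_p),
    unitarily_similar (block_mx 0 B 0 C) (block_mx (J2 F) 0 0 D).
Proof.
move=> BC xx xC' xC.
have xB : x *m B ^t* *m B = x.
  rewrite -mulmxA -[B ^t* *m B](addrK (C ^t* *m C)) BC mulmxBr mulmx1.
  by rewrite mulmxA xC' mul0mx subr0.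
set T := block_mx 0 B 0 C.
have T' : T ^t* = block_mx 0 0 (B ^t*) (C ^t*).
  by rewrite tr_block_mx map_block_mx !trmxC0.
pose f : 'rV_(m + k) := row_mx 0 x.
pose g : 'rV_(m + k) := row_mx (x *m B ^t*) 0.
have fT : f *m T = 0.
  by rewrite mul_row_block !mul0mx mulmx0 xC !addr0 row_mx0.
have fT' : f *m T ^t* = g.
  by rewrite T' mul_row_block !mul0mx xC' !add0r.
have gT : g *m T = f.
  by rewrite mul_row_block !mul0mx !mulmx0 xB !addr0.
have gT' : g *m T ^t* = 0.
  by rewrite T' mul_row_block !mul0mx !mulmx0 !addr0 row_mx0.
have ff : f *m f ^t* = 1%:M.
  by rewrite tr_row_mx map_col_mx mul_row_col mul0mx add0r.
have gf : g *m f ^t* = 0.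
  by rewrite tr_row_mx map_col_mx mul_row_col mul0mx trmxC0 mulmx0 addr0.
have fg : f *m g ^t* = 0 by rewrite -[f]trmxCK -trmxCM gf trmxC0.
have gg : g *m g ^t* = 1%:M.
  by rewrite -{2}fT' trmxCM trmxCK mulmxA gT.
pose Q : 'M[F]_(1 + 1, m + k) := col_mx g f.
have J2E : J2 F = block_mx (0 : 'M[F]_1) 1%:M (0 : 'M[F]_1) (0 : 'M[F]_1).
  apply/matrixP => i j; rewrite !mxE.
  by case: splitP => i' /= iE; rewrite !mxE; case: splitP => j' /= jE;
     rewrite !mxE -!val_eqE /= iE jE ?ord1.
apply: (@reducing_block _ _ _ _ _ Q).
- apply/unitarymxP; rewrite tr_col_mx map_row_mx mul_col_row gg gf fg ff.
  by rewrite -scalar_mx_block.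
- by rewrite J2E mul_col_mx gT fT mul_block_col !mul0mx mul1mx !add0r.
- rewrite J2E tr_block_mx map_block_mx !trmxC0 trmxC1 mul_col_mx gT' fT'.
  by rewrite mul_block_col !mul0mx mul1mx !addr0.
Qed.

(** * Partial isometries *)

Lemma cdotE (F : numClosedFieldType) n (x y : 'cV[F]_n) :
  cdot x y = (y ^t* *m x) 0 0.
Proof.
rewrite /cdot dotmxE !mxE; apply: eq_bigr => i _.
by rewrite !mxE mulrC.
Qed.

Lemma partial_isometry_cdot (F : numClosedFieldType) n (A : 'M[F]_n)
    (x : 'cV_n) :
  partial_isometry A -> (forall y : 'cV_n, A *m y = 0 -> cdot x y = 0) ->
  (A *m x) ^t* *m (A *m x) = x ^t* *m x.
Proof.
move=> pA /pA; rewrite /cnorm => /(congr1 (fun z => z ^+ 2)).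
rewrite !sqrtCK !cdotE => xE.
by rewrite [LHS]mx11_scalar xE -mx11_scalar.
Qed.

(** As the block matrix has rank [k], its kernel is the first summand; its
    orthogonal complement, the second summand, is thus mapped isometrically. *)
Lemma partial_isometry_block (F : numClosedFieldType) n m k (A : 'M[F]_n)
    (B : 'M[F]_(m, k)) (C : 'M[F]_k) :
  partial_isometry A -> \rank A = k ->
  unitarily_similar A (block_mx 0 B 0 C) ->
  B ^t* *m B + C ^t* *m C = 1%:M.
Proof.
move=> pA rA [U [/unitarymxP U1 /unitarymxP]]; rewrite trmxCK => U2 AE.
pose G := col_mx B C.
have TG : block_mx (0 : 'M[F]_m) B 0 C = row_mx 0 G by rewrite block_mxEh col_mx0.
have /row_fullP [L LG] : row_full G.
  rewrite /row_full eqn_leq rank_leq_col -{1}rA AE TG.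
  rewrite (leq_trans (mxrankM_maxl _ _)) // (leq_trans (mxrankM_maxr _ _)) //.
  by rewrite rank_row_0mx.
have GG : G ^t* *m G = B ^t* *m B + C ^t* *m C.
  by rewrite tr_col_mx map_row_mx mul_row_col.
rewrite -GG; apply/eqP; rewrite -subr_eq0; apply/eqP.
apply: hermitian_form_eq0 => [|v].
  by rewrite raddfB map_mxB /= trmxCM trmxCK trmxC1.
pose x := U *m col_mx 0 (v ^t*).
have AU (z : 'cV_(m + k)) : A *m (U *m z) = U *m (G *m dsubmx z).
  rewrite AE -!mulmxA [U ^t* *m _]mulmxA U2 mul1mx TG.
  by rewrite -{1}[z]vsubmxK mul_row_col mul0mx add0r.
have /(partial_isometry_cdot pA) : forall y : 'cV_n, A *m y = 0 -> cdot x y = 0.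
  move=> y Ay.
  have yE : y = U *m (U ^t* *m y) by rewrite mulmxA U1 mul1mx.
  have y0 : dsubmx (U ^t* *m y) = 0.
    have := congr1 (mulmx (L *m U ^t*)) Ay.
    rewrite {1}yE AU mulmx0 -!mulmxA [U ^t* *m (U *m _)]mulmxA U2 mul1mx.
    by rewrite mulmxA LG mul1mx.
  rewrite cdotE /x mulmxA -[y ^t* *m U]trmxCK trmxCM trmxCK.
  rewrite -[U ^t* *m y]vsubmxK y0 tr_col_mx map_row_mx trmxC0.
  by rewrite mul_row_col mulmx0 mul0mx addr0 mxE.
rewrite AU col_mxKd /x !trmxCM -!mulmxA ![U ^t* *m (U *m _)]mulmxA U2 !mul1mx.
rewrite [(col_mx 0 _)^T]tr_col_mx map_row_mx trmxC0 trmxCK.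
rewrite mul_row_col mul0mx add0r => E.
by rewrite mulmxBl mulmxBr mul1mx -!mulmxA E subrr.
Qed.

(** * The Kippenhahn polynomial at angle zero *)

Lemma expi0 (R : realType) : expi (0 : R) = 1.
Proof. by rewrite /expi cos0 sin0. Qed.

Lemma kippenhahn_root (R : realType) n (A : 'M[R[i]]_n) (theta : R) a :
  root (kippenhahn_poly A theta) a ->
  eigenvalue (Remx (expi theta *: A)) a.
Proof.
rewrite eigenvalue_root_char /char_poly /char_poly_mx /kippenhahn_poly.
rewrite -opprB -scaleN1r detZ rootM; case/orP => //.
by rewrite rootE horner_exp hornerN hornerC signr_eq0.
Qed.

Lemma kippenhahn_circle_eigenvector (R : realType) n (A : 'M[R[i]]_n)
    (e : R[i]) :
  kippenhahn_contains_circle A (1 / 2) -> e ^+ 2 = 1 ->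
  exists2 v : 'rV_n, v *m (A + A ^t*) = e *: v & v != 0.
Proof.
move=> /(_ 0) dvd e2.
have : eigenvalue (Remx A) (e / 2).
  have -> : Remx A = Remx (expi 0 *: A) by rewrite expi0 scale1r.
  apply: kippenhahn_root.
  rewrite -dvdp_XsubCl; apply: dvdp_trans dvd; rewrite dvdp_XsubCl rootE.
  rewrite !hornerE exprMn e2 !mul1r.
  by rewrite !rmorphXn /= fmorphV rmorph_nat subrr.
move=> /eigenvalueP [v vE v0]; exists v => //.
by move: vE; rewrite /Remx -scalemxAr mulrC -scalerA => /(scalerI _) -> //.
Qed.

(** For an eigenvector [(a, b)], the first component of the equation gives
    [a = e (b B^* )]; substituting it in the second component and using
    [B^* B = 1 - C^* C] leaves an equation in [b] alone. *)
Lemma block_eigenvector (F : numClosedFieldType) n m k (A : 'M[F]_n)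
    (B : 'M[F]_(m, k)) (C : 'M[F]_k) (e : F) (v : 'rV_n) :
  unitarily_similar A (block_mx 0 B 0 C) ->
  B ^t* *m B + C ^t* *m C = 1%:M -> e ^+ 2 = 1 ->
  v *m (A + A ^t*) = e *: v -> v != 0 ->
  exists2 b : 'rV_k, b != 0 &
    b *m C ^t* *m C = e *: (b *m (C ^t* + C)).
Proof.
move=> [U [/unitarymxP U1 /unitarymxP]]; rewrite trmxCK => U2 AE BC e2 vE v0.
have e0 : e != 0.
  by apply: contra_eqN e2 => /eqP ->; rewrite expr0n /= eq_sym oner_eq0.
set T := block_mx 0 B 0 C in AE.
pose w := v *m U.
have w0 : w != 0.
  by apply: contraNneq v0 => w0; rewrite -[v]mulmx1 -U1 mulmxA -/w w0 mul0mx.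
have wT : w *m (T + T ^t*) = e *: w.
  have AT : A + A ^t* = U *m (T + T ^t*) *m U ^t*.
    by rewrite AE !trmxCM trmxCK mulmxA mulmxDr mulmxDl.
  by rewrite /w scalemxAl -vE AT -!mulmxA U2 mulmx1.
have T' : T ^t* = block_mx 0 0 (B ^t*) (C ^t*).
  by rewrite tr_block_mx map_block_mx !trmxC0.
pose a := lsubmx w; pose b := rsubmx w.
have wE : w = row_mx a b by rewrite hsubmxK.
move: wT; rewrite T' add_block_mx !add0r addr0 wE mul_row_block scale_row_mx.
rewrite mulmx0 add0r => /eq_row_mx [ba bb].
exists b.
  apply: contraNneq w0 => b0; move/eqP: ba.
  rewrite b0 mul0mx eq_sym scaler_eq0 (negPf e0) /= => /eqP a0.
  by rewrite wE a0 b0 row_mx0.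
have bBB : b *m B ^t* *m B = e *: (a *m B) by rewrite ba -scalemxAl.
have -> : b *m C ^t* *m C = b - e *: (a *m B).
  rewrite -bBB; apply/eqP; rewrite eq_sym subr_eq addrC -mulmxA.
  by rewrite -[b *m _ *m C]mulmxA -mulmxDr BC mulmx1.
rewrite [C ^t* + C]addrC; apply/eqP; rewrite subr_eq -scalerDr [_ + a *m B]addrC bb.
by rewrite scalerA -expr2 e2 scale1r.
Qed.

Theorem theorem3p1 (R : realType) (n k : nat) (A : 'M[R[i]]_n)
    (B : 'M[R[i]]_(n - k, k)) (C : 'M[R[i]]_k) :
  partial_isometry A ->
  \rank A = k ->
  kippenhahn_contains_circle A (1 / 2) ->
  unitarily_similar A (block_mx 0 B 0 C) ->
  (k %/ 2 <= dim_ker C)%N ->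
  exists (p : nat) (D : 'M[R[i]]_p),
    unitarily_similar A (block_mx (J2 R[i]) 0 0 D).
Proof.
move=> pA rA circ sA dimK.
have BC := partial_isometry_block pA rA sA.
have sqr1 : 1 ^+ 2 = 1 :> R[i] by rewrite expr1n.
have sqrN1 : (-1) ^+ 2 = 1 :> R[i] by rewrite sqrrN expr1n.
have [u uE u0] := kippenhahn_circle_eigenvector circ sqr1.
have [v vE v0] := kippenhahn_circle_eigenvector circ sqrN1.
have [b b0 bE] := block_eigenvector sA BC sqr1 uE u0.
have [c c0 cE] := block_eigenvector sA BC sqrN1 vE v0.
have : (kermx (C ^t*) :&: kermx (C ^t* ^t*))%MS != 0.
  apply: (ker_cap_adjoint_neq0 b0 c0).
  - by rewrite trmxCK bE scale1r.
  - by rewrite trmxCK cE scaleN1r.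
  - by rewrite mxrank_ker mxrank_map mxrank_tr -mxrank_coker.
move=> /unit_row_vector [x xx].
rewrite sub_capmx trmxCK => /andP [/sub_kermxP xC' /sub_kermxP xC].
have [p [D sD]] := J2_block BC xx xC' xC.
by exists p, D; exact: unitarily_similar_trans sA sD.
Qed.
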